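(* Let $1\leq p<\infty$ and let $Y$ be a Banach space with norm $\|\cdot\|_Y$ that is compactly embedded into $L^p(\mathbb{T})$. Then there exists a sequence $(\varepsilon_n)_{n\geq 0}$ of nonnegative real numbers with $\varepsilon_n\searrow 0$ such that $|c_n(y)|\leq \varepsilon_{|n|}\|y\|_Y$ for all $n\in\mathbb{Z}$ and all $y\in Y$, where $c_n(f)=\frac{1}{2\pi}\int_0^{2\pi}f(t)e^{-int}\,dt$ denotes the $n$-th Fourier coefficient of $f$.
   Context: $L^p(\mathbb{T})$ is the usual Banach space of (classes of) $2\pi$-periodic measurable functions $f:\mathbb{T}\to\mathbb{C}$ with $\int_0^{2\pi}|f(t)|^p\,dt<\infty$. A Banach space $(Y,\|\cdot\|_Y)$ is compactly embedded into a Banach space $X$ if $Y$ is a linear subspace of $X$ and the inclusion map $(Y,\|\cdot\|_Y)\to (X,\|\cdot\|_X)$ is a compact operator, i.e. the unit ball $\{y\in Y:\|y\|_Y\leq 1\}$ is relatively compact in $X$. The norm $\|\cdot\|_Y$ is in general not the restriction of $\|\cdot\|_X$. The notation $\varepsilon_n\searrow 0$ means that $(\varepsilon_n)$ is nonincreasing and converges to $0$. *)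

(* Defs.v *)
From HB Require Import structures.
From mathcomp Require Import all_boot all_order all_algebra.
From mathcomp Require Import generic_quotient ring_quotient.
From mathcomp Require Import all_classical all_reals all_analysis.
From mathcomp Require Import measurable_realfun.
From mathcomp Require Import complex.
Import Order.TTheory GRing.Theory Num.Theory.
Import numFieldNormedType.Exports.
Import Normc.

Set Implicit Arguments.
Unset Strict Implicit.
Unset Printing Implicit Defensive.

Local Open Scope classical_set_scope.
Local Open Scope ring_scope.
Local Open Scope complex_scope.
Local Open Scope quotient_scope.

(* One period of the circle.  It carries the unnormalised Lebesgue measure dt. *)
Definition onecycle (R : realType) : set R := `[0, 2 * pi].
Arguments onecycle {R}.

(* Locked because unification otherwise unfolds the integral and the power when
   it compares the norms of two functions. *)
HB.lock Definition Lp_norm (R : realType) (p : R) (f : R -> R[i]) : R :=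
  (\int[@lebesgue_measure R]_(t in onecycle) (normc (f t)) `^ p) `^ p^-1.
Canonical locked_Lp_norm := Unlockable Lp_norm.unlock.

Section defs.
Variable R : realType.
Notation mu := (@lebesgue_measure R).
Implicit Types (f g : R -> R[i]) (p : R).

(* The library puts no sigma-algebra on R[i]; Borel measurability of a
   complex-valued function is measurability of its real and imaginary parts.
   Borel and Lebesgue measurable functions give the same a.e.-classes. *)
Definition cmeasurable f : Prop :=
  measurable_fun setT (fun t => complex.Re (f t)) /\
  measurable_fun setT (fun t => complex.Im (f t)).

Record is_Lp_periodic p f : Prop := IsLpPeriodic {
  Lp_periodic : forall t, f (t + 2 * pi) = f t ;
  Lp_measurable : cmeasurable f ;
  Lp_finite : (\int[mu]_(t in onecycle) ((normc (f t)) `^ p)%:E < +oo)%E }.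

Definition cintegral f : R[i] :=
  (\int[mu]_(t in onecycle) complex.Re (f t)) +i*
  (\int[mu]_(t in onecycle) complex.Im (f t)).

Definition expi (x : R) : R[i] := cos x +i* sin x.

Definition fourier_coef f (n : int) : R[i] :=
  ((2 * pi)^-1)%:C * cintegral (fun t => f t * expi (- (n%:~R * t))).

Lemma measurable_onecycle : measurable (@onecycle R).
Proof. exact: measurable_itv. Qed.

Lemma normc_ge0 (z : R[i]) : 0 <= normc z.
Proof. by case: z => a b /=; exact: sqrtr_ge0. Qed.

Lemma normc_triangle (x y : R[i]) : normc (x + y) <= normc x + normc y.
Proof. exact: le_normcD. Qed.

Lemma cmeasurable_normc f : cmeasurable f -> measurable_fun setT (@normc R \o f).
Proof.
move=> [mr mi].
have -> : @normc R \o f =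
    @Num.sqrt R \o (fun t => complex.Re (f t) ^+ 2 + complex.Im (f t) ^+ 2).
  by apply/funext => t /=; case: (f t).
apply: measurableT_comp.
  by apply: continuous_measurable_fun; exact: sqrt_continuous.
by apply: measurable_funD; exact: measurable_funX.
Qed.

Lemma cmeasurable_normcX p f : cmeasurable f ->
  measurable_fun setT (fun t => (normc (f t)) `^ p).
Proof.
by move=> mf; apply: (measurableT_comp (measurable_powR p));
  exact: cmeasurable_normc.
Qed.

(* |f| extended by 0 outside one period: the L^p norm over one period is then
   the library's Lnorm over the real line. *)
Definition trunc_norm f : R -> R := (@normc R \o f) \_ onecycle.

Lemma measurable_trunc_norm f : cmeasurable f ->
  measurable_fun setT (trunc_norm f).
Proof.
move=> mf; apply/(measurable_restrictT _ measurable_onecycle).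
by apply: measurable_funTS; exact: cmeasurable_normc.
Qed.

Lemma trunc_norm_ge0 f t : 0 <= trunc_norm f t.
Proof. by rewrite /trunc_norm /patch; case: ifP => // _; exact: normc_ge0. Qed.

Lemma trunc_normD f g t :
  trunc_norm (f \+ g) t <= trunc_norm f t + trunc_norm g t.
Proof.
rewrite /trunc_norm /patch; case: ifP => _; last by rewrite addr0.
exact: normc_triangle.
Qed.

Local Open Scope ereal_scope.

Lemma Lnorm_trunc p f : (1 <= p)%R ->
  'N[mu]_p%:E[EFin \o trunc_norm f] =
  (\int[mu]_(t in onecycle) ((normc (f t)) `^ p)%:E) `^ p^-1.
Proof.
move=> p1; rewrite unlock [X in _ = X `^ _]integral_mkcond; congr (_ `^ _).
apply: eq_integral => t _ /=.
rewrite ger0_norm ?trunc_norm_ge0// /trunc_norm /patch.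
case: ifP => //= _.
by rewrite powR0// gt_eqF// (lt_le_trans ltr01 p1).
Qed.

Lemma Lp_int_ge0 p f :
  0 <= \int[mu]_(t in onecycle) ((normc (f t)) `^ p)%:E.
Proof. by apply: integral_ge0 => t _; rewrite lee_fin powR_ge0. Qed.

Lemma Lp_finite_num p f : is_Lp_periodic p f ->
  \int[mu]_(t in onecycle) ((normc (f t)) `^ p)%:E \is a fin_num.
Proof. by move=> [_ _ fin]; rewrite ge0_fin_numE// Lp_int_ge0. Qed.

Lemma Lp_normE p f : (1 <= p)%R -> is_Lp_periodic p f ->
  (Lp_norm p f)%:E = 'N[mu]_p%:E[EFin \o trunc_norm f].
Proof.
by move=> p1 Lf; rewrite unlock Lnorm_trunc// -[in RHS](fineK (Lp_finite_num Lf)).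
Qed.

Lemma Lnorm_truncD p f g : (1 <= p)%R -> cmeasurable f -> cmeasurable g ->
  cmeasurable (f \+ g)%R ->
  'N[mu]_p%:E[EFin \o trunc_norm (f \+ g)%R] <=
  'N[mu]_p%:E[EFin \o trunc_norm f] + 'N[mu]_p%:E[EFin \o trunc_norm g].
Proof.
move=> p1 mf mg mfg.
have p0 : (0 <= p)%R by rewrite (le_trans ler01).
have mtf := measurable_trunc_norm mf; have mtg := measurable_trunc_norm mg.
have := minkowski_EFin mu mtf mtg p1.
move=> mink; apply: le_trans mink.
rewrite unlock; apply: gt0_ler_poweR; first by rewrite invr_ge0.
- by rewrite in_itv/= leey andbT integral_ge0// => t _; exact: poweR_ge0.
- by rewrite in_itv/= leey andbT integral_ge0// => t _; exact: poweR_ge0.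
have mp (h : R -> R) : measurable_fun setT h ->
    measurable_fun setT (fun t => `|(h t)%:E| `^ p).
  move=> mh; rewrite -[X in measurable_fun _ X]/
    ((fun x : \bar R => x `^ p) \o (fun t => `|(h t)%:E|)).
  apply: measurableT_comp; first exact: measurable_poweR.
  by apply: measurableT_comp => //; exact/measurable_EFinP.
apply: ge0_le_integral => //.
- by move=> t _; exact: poweR_ge0.
- exact: (mp _ (measurable_trunc_norm mfg)).
- exact: (mp _ (measurable_funD mtf mtg)).
move=> t _ /=; rewrite lee_fin.
rewrite !ger0_norm ?addr_ge0 ?trunc_norm_ge0//.
by rewrite ge0_ler_powR ?nnegrE ?addr_ge0 ?trunc_norm_ge0// trunc_normD.
Qed.

Lemma cmeasurableD f g :
  cmeasurable f -> cmeasurable g -> cmeasurable (f \+ g)%R.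
Proof.
move=> [mf1 mf2] [mg1 mg2]; split => /=.
  rewrite (_ : (fun t => _) =
    (fun t => complex.Re (f t)) \+ (fun t => complex.Re (g t)))%R.
    exact: measurable_funD.
  by apply/funext => t /=; case: (f t) (g t) => [? ?] [? ?].
rewrite (_ : (fun t => _) =
  (fun t => complex.Im (f t)) \+ (fun t => complex.Im (g t)))%R.
  exact: measurable_funD.
by apply/funext => t /=; case: (f t) (g t) => [? ?] [? ?].
Qed.

Lemma cmeasurableM f g :
  cmeasurable f -> cmeasurable g -> cmeasurable (fun t => f t * g t)%R.
Proof.
move=> [mf1 mf2] [mg1 mg2]; split.
  rewrite (_ : (fun t => _) = (fun t => complex.Re (f t) * complex.Re (g t) -
    complex.Im (f t) * complex.Im (g t))%R).
    by apply: measurable_funB; exact: measurable_funM.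
  by apply/funext => t /=; case: (f t) (g t) => [? ?] [? ?].
rewrite (_ : (fun t => _) = (fun t => complex.Re (f t) * complex.Im (g t) +
  complex.Im (f t) * complex.Re (g t))%R).
  by apply: measurable_funD; exact: measurable_funM.
by apply/funext => t /=; case: (f t) (g t) => [? ?] [? ?].
Qed.

Lemma cmeasurable_cst (a : R[i]) : cmeasurable (fun=> a).
Proof. by split; exact: measurable_cst. Qed.

Lemma Lp_periodicD p f g : (1 <= p)%R ->
  is_Lp_periodic p f -> is_Lp_periodic p g -> is_Lp_periodic p (f \+ g)%R.
Proof.
move=> p1 Lf Lg.
have p0 : p != 0%R by rewrite gt_eqF// (lt_le_trans ltr01 p1).
have mfg := cmeasurableD (Lp_measurable Lf) (Lp_measurable Lg).
split => //.
  by move=> t /=; rewrite (Lp_periodic Lf) (Lp_periodic Lg).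
have := Lnorm_truncD p1 (Lp_measurable Lf) (Lp_measurable Lg) mfg.
rewrite -(Lp_normE p1 Lf) -(Lp_normE p1 Lg) -EFinD Lnorm_trunc// => h.
have p'0 : p^-1%R != 0%R by rewrite invr_neq0.
by apply: (lty_poweRy p'0); rewrite (le_lt_trans h)// ltry.
Qed.

Lemma normc_scale_int p (a : R[i]) f : (1 <= p)%R -> cmeasurable f ->
  \int[mu]_(t in onecycle) ((normc (a * f t)%R) `^ p)%:E =
  ((normc a) `^ p)%:E * \int[mu]_(t in onecycle) ((normc (f t)) `^ p)%:E.
Proof.
move=> p1 mf; rewrite -ge0_integralZl//=.
- by apply: eq_integral => t _; rewrite normcM powRM ?normc_ge0// EFinM.
- exact: measurable_onecycle.
- by apply/measurable_EFinP; apply: measurable_funTS; exact: cmeasurable_normcX.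
- by move=> t _; rewrite lee_fin powR_ge0.
- by rewrite lee_fin powR_ge0.
Qed.

Lemma Lp_periodicZ p (a : R[i]) f : (1 <= p)%R ->
  is_Lp_periodic p f -> is_Lp_periodic p (fun t => a * f t)%R.
Proof.
move=> p1 Lf; have [fper mf ffin] := Lf; split.
- by move=> t; rewrite fper.
- exact: (cmeasurableM (cmeasurable_cst a)).
- rewrite normc_scale_int// lte_mul_pinfty ?lee_fin ?powR_ge0//.
Qed.

Lemma Lp_periodic0 p : (1 <= p)%R -> is_Lp_periodic p (fun=> 0%R).
Proof.
move=> p1; split => //.
rewrite integral0_eq// => t _.
by rewrite normc0 powR0// gt_eqF// (lt_le_trans ltr01 p1).
Qed.

Local Open Scope ring_scope.

Lemma Lp_normD p f g : 1 <= p -> is_Lp_periodic p f -> is_Lp_periodic p g ->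
  Lp_norm p (f \+ g) <= Lp_norm p f + Lp_norm p g.
Proof.
move=> p1 Lf Lg; have Lfg := Lp_periodicD p1 Lf Lg.
have := Lnorm_truncD p1 (Lp_measurable Lf) (Lp_measurable Lg)
  (Lp_measurable Lfg).
by rewrite -(Lp_normE p1 Lf) -(Lp_normE p1 Lg) -(Lp_normE p1 Lfg) -EFinD lee_fin.
Qed.

Lemma Lp_normZ p (a : R[i]) f : 1 <= p -> is_Lp_periodic p f ->
  Lp_norm p (fun t => a * f t) = normc a * Lp_norm p f.
Proof.
move=> p1 Lf; have p0 : p != 0 by rewrite gt_eqF// (lt_le_trans ltr01 p1).
rewrite unlock /Rintegral (normc_scale_int a p1 (Lp_measurable Lf)).
have I0 : 0 <= fine (\int[mu]_(t in onecycle) ((normc (f t)) `^ p)%:E)%E.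
  by rewrite fine_ge0// Lp_int_ge0.
rewrite fineM ?(Lp_finite_num Lf)//= (powRM _ (powR_ge0 _ _) I0).
by rewrite -powRrM mulfV// powRr1// normc_ge0.
Qed.

Lemma Lp_norm0P p f : 1 <= p -> is_Lp_periodic p f ->
  Lp_norm p f = 0 <-> ae_eq mu onecycle f (fun=> 0).
Proof.
move=> p1 Lf; have p0 : p != 0 by rewrite gt_eqF// (lt_le_trans ltr01 p1).
have mf := Lp_measurable Lf.
have mI : measurable_fun onecycle (fun t => ((normc (f t)) `^ p)%:E).
  by apply/measurable_EFinP; apply: measurable_funTS; exact: cmeasurable_normcX.
have absE : (\int[mu]_(t in onecycle) `|((normc (f t)) `^ p)%:E| =
    \int[mu]_(t in onecycle) ((normc (f t)) `^ p)%:E)%E.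
  by apply: eq_integral => t _; rewrite gee0_abs// lee_fin powR_ge0.
have := ae_eq_integral_abs mu measurable_onecycle mI; rewrite absE => h.
have pt t : ((normc (f t)) `^ p)%:E = 0%E <-> f t = 0.
  split=> [[/eqP]|->]; last by rewrite normc0 powR0.
  by rewrite powR_eq0 => /andP[/eqP/eq0_normc].
split.
  rewrite unlock => /powR_eq0_eq0 I0; have {}/h : (\int[mu]_(t in onecycle)
      ((normc (f t)) `^ p)%:E = 0)%E.
    by rewrite -(fineK (Lp_finite_num Lf)) [X in X%:E]I0.
  by apply: filterS => t /[apply] /pt.
move=> ae0; rewrite unlock /Rintegral (_ : integral _ _ _ = 0%E); last first.
  by apply/h; move: ae0; apply: filterS => t /[apply] /pt.
by rewrite powR0// invr_neq0.
Qed.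

Lemma cmeasurable_expi (n : int) : cmeasurable (fun t => expi (- (n%:~R * t))).
Proof.
have m : measurable_fun setT (fun t : R => - (n%:~R * t)).
  by apply: measurableT_comp => //; exact: measurable_funM.
split => /=; apply: measurableT_comp m; apply: continuous_measurable_fun.
  exact: continuous_cos.
exact: continuous_sin.
Qed.

Lemma ae_eq_cintegral f g : cmeasurable f -> cmeasurable g ->
  ae_eq mu onecycle f g -> cintegral f = cintegral g.
Proof.
move=> [mf1 mf2] [mg1 mg2] fg; congr (_ +i* _); congr fine.
  apply: ae_eq_integral; first exact: measurable_onecycle.
  - by apply/measurable_EFinP; exact: measurable_funTS.
  - by apply/measurable_EFinP; exact: measurable_funTS.
  - by move: fg; apply: filterS => t /[apply] ->.
apply: ae_eq_integral; first exact: measurable_onecycle.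
- by apply/measurable_EFinP; exact: measurable_funTS.
- by apply/measurable_EFinP; exact: measurable_funTS.
- by move: fg; apply: filterS => t /[apply] ->.
Qed.

Lemma ae_eq_fourier_coef f g (n : int) : cmeasurable f -> cmeasurable g ->
  ae_eq mu onecycle f g -> fourier_coef f n = fourier_coef g n.
Proof.
move=> mf mg fg; congr (_ * _); apply: ae_eq_cintegral.
- exact: (cmeasurableM mf (cmeasurable_expi n)).
- exact: (cmeasurableM mg (cmeasurable_expi n)).
- by move: fg; apply: filterS => t /[apply] ->.
Qed.

End defs.

Section Lp_torus.
Variables (R : realType) (p : R) (p1 : 1 <= p).

(* The proof of 1 <= p is an argument so that the closure instances, hence the
   vector space structure, can be inferred. *)
Definition Lp_pred of 1 <= p : {pred R -> R[i]} :=
  mem [set f | is_Lp_periodic p f].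

Lemma Lp_predE f : (f \in Lp_pred p1) = `[< is_Lp_periodic p f >].
Proof. by apply/idP/asboolP; rewrite !inE. Qed.

Lemma Lp_pred_submod_closed : submod_closed (Lp_pred p1).
Proof.
split=> [|a f g]; rewrite !Lp_predE; first exact/asboolP/Lp_periodic0.
move=> /asboolP Lf /asboolP Lg; apply/asboolP.
by apply: Lp_periodicD => //; exact: Lp_periodicZ.
Qed.

HB.instance Definition _ :=
  GRing.isSubmodClosed.Build R[i] (R -> R[i]) (Lp_pred p1) Lp_pred_submod_closed.

Record Lp_fun := LpFun { Lp_val :> R -> R[i] ; _ : Lp_val \in Lp_pred p1 }.

HB.instance Definition _ := [isSub for Lp_val].
HB.instance Definition _ := [Choice of Lp_fun by <:].
HB.instance Definition _ := [SubChoice_isSubLmodule of Lp_fun by <:].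

Lemma Lp_funP (f : Lp_fun) : is_Lp_periodic p f.
Proof. by case: f => f /=; rewrite Lp_predE => /asboolP. Qed.

Definition Lp_null : {pred Lp_fun} :=
  mem [set f : Lp_fun | ae_eq (@lebesgue_measure R) (@onecycle R)
    (Lp_val f) (fun=> 0)].

Lemma Lp_nullP (f : Lp_fun) : reflect (Lp_norm p f = 0) (f \in Lp_null).
Proof.
apply: (iffP idP); first by rewrite inE /= => /(Lp_norm0P p1 (Lp_funP f)).
by move=> /(Lp_norm0P p1 (Lp_funP f)) f0; rewrite inE.
Qed.

Lemma Lp_norm_ge0 f : 0 <= Lp_norm p f.
Proof. by rewrite unlock; exact: powR_ge0. Qed.

Lemma Lp_null_submod_closed : submod_closed Lp_null.
Proof.
split=> [|a f g].
  by rewrite inE; apply: aeW => t.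
move=> /Lp_nullP f0 /Lp_nullP g0; apply/Lp_nullP.
apply/eqP; rewrite eq_le Lp_norm_ge0 andbT.
have Laf := Lp_periodicZ a p1 (Lp_funP f).
by rewrite (le_trans (Lp_normD p1 Laf (Lp_funP g)))// g0 addr0 Lp_normZ// ?f0
  ?mulr0//; exact: Lp_funP.
Qed.

HB.instance Definition _ :=
  GRing.isSubmodClosed.Build R[i] Lp_fun Lp_null Lp_null_submod_closed.

(* L^p(T): 2 pi-periodic functions modulo those that vanish almost everywhere on
   [0, 2 pi], which by periodicity means almost everywhere on the real line. *)
Definition Lp_torus : Type := Quotient.quot Lp_null.
HB.instance Definition _ := GRing.Zmodule.on Lp_torus.
HB.instance Definition _ := EqQuotient.on Lp_torus.

Definition pi_Lp : Lp_fun -> Lp_torus := \pi_(Quotient.quot Lp_null).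

Lemma pi_LpE (f g : Lp_fun) : pi_Lp f = pi_Lp g <-> f - g \in Lp_null.
Proof. by rewrite Quotient.idealrBE; split=> [h|/eqP//]; apply/eqP. Qed.

Lemma pi_LpD (f g : Lp_fun) : pi_Lp (f + g) = pi_Lp f + pi_Lp g.
Proof. exact: (Quotient.pi_add Lp_null f g). Qed.

Lemma pi_Lp_repr (x : Lp_torus) : pi_Lp (repr x) = x.
Proof. exact: reprK. Qed.

Definition Lp_scale (a : R[i]) (x : Lp_torus) : Lp_torus :=
  pi_Lp (a *: (repr x : Lp_fun)).

Lemma pi_LpZ (a : R[i]) (f : Lp_fun) : pi_Lp (a *: f) = Lp_scale a (pi_Lp f).
Proof.
by apply/pi_LpE; rewrite -scalerBr; apply: rpredZ; apply/pi_LpE; rewrite pi_Lp_repr.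
Qed.

Lemma Lp_scaleA (a b : R[i]) (x : Lp_torus) :
  Lp_scale a (Lp_scale b x) = Lp_scale (a * b) x.
Proof. by rewrite -(pi_Lp_repr x) -!pi_LpZ scalerA. Qed.

Lemma Lp_scale1 : left_id 1 Lp_scale.
Proof. by move=> x; rewrite -(pi_Lp_repr x) -!pi_LpZ scale1r. Qed.

Lemma Lp_scaleDr : right_distributive Lp_scale +%R.
Proof.
move=> a x y; rewrite -(pi_Lp_repr x) -(pi_Lp_repr y) -pi_LpD -!pi_LpZ.
by rewrite scalerDr pi_LpD.
Qed.

Lemma Lp_scaleDl (x : Lp_torus) : {morph Lp_scale^~ x : a b / a + b}.
Proof.
by move=> a b; rewrite -(pi_Lp_repr x) -!pi_LpZ scalerDl pi_LpD.
Qed.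

HB.instance Definition _ := GRing.Zmodule_isLmodule.Build R[i] Lp_torus
  Lp_scaleA Lp_scale1 Lp_scaleDr Lp_scaleDl.

(* In a normed module over R[i] the norm is R[i]-valued, with values in the
   nonnegative reals. *)
Definition Lp_torus_norm (x : Lp_torus) : R[i] :=
  (Lp_norm p (repr x : Lp_fun))%:C.

Lemma Lp_norm_subr_eq0 (f g : Lp_fun) :
  f - g \in Lp_null -> Lp_norm p f <= Lp_norm p g.
Proof.
move=> /Lp_nullP fg0.
have -> : Lp_val f = (Lp_val (f - g) \+ Lp_val g)%R.
  by apply/funext => t /=; rewrite subrK.
apply: (le_trans (Lp_normD p1 (Lp_funP (f - g)) (Lp_funP g))).
by rewrite -lerBrDr subrr le_eqVlt; apply/orP; left; apply/eqP.
Qed.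

Lemma Lp_torus_norm_pi (f : Lp_fun) : Lp_torus_norm (pi_Lp f) = (Lp_norm p f)%:C.
Proof.
congr (_%:C); apply/eqP; rewrite eq_le.
by apply/andP; split; apply: Lp_norm_subr_eq0; apply/pi_LpE; rewrite pi_Lp_repr.
Qed.

Lemma Lp_torus_normD (x y : Lp_torus) :
  Lp_torus_norm (x + y) <= Lp_torus_norm x + Lp_torus_norm y.
Proof.
rewrite -(pi_Lp_repr x) -(pi_Lp_repr y) -pi_LpD !Lp_torus_norm_pi.
by rewrite -rmorphD lecR; apply: Lp_normD => //; exact: Lp_funP.
Qed.

Lemma Lp_torus_normZ (a : R[i]) (x : Lp_torus) :
  Lp_torus_norm (a *: x) = `|a| * Lp_torus_norm x.
Proof.
rewrite -(pi_Lp_repr x) -[_ *: _]pi_LpZ !Lp_torus_norm_pi.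
by rewrite (Lp_normZ a p1 (Lp_funP _)) rmorphM.
Qed.

Lemma Lp_torus_norm0 (x : Lp_torus) : Lp_torus_norm x = 0 -> x = 0.
Proof.
rewrite -(pi_Lp_repr x) Lp_torus_norm_pi => -[x0].
have -> : 0 = pi_Lp 0 by apply: (addrI (pi_Lp 0)); rewrite -pi_LpD !addr0.
by apply/pi_LpE; rewrite subr0; apply/Lp_nullP.
Qed.

HB.instance Definition _ := Lmodule_isNormed.Build R[i] Lp_torus
  Lp_torus_normD Lp_torus_normZ Lp_torus_norm0.

(* Computed on an arbitrary representative of the class; Lp_fourier_coef_pi shows
   that the choice does not matter. *)
Definition Lp_fourier_coef (x : Lp_torus) (n : int) : R[i] :=
  fourier_coef (repr x : Lp_fun) n.

Lemma Lp_fourier_coef_pi (f : Lp_fun) (n : int) :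
  Lp_fourier_coef (pi_Lp f) n = fourier_coef f n.
Proof.
have /pi_LpE : pi_Lp (repr (pi_Lp f)) = pi_Lp f by rewrite pi_Lp_repr.
rewrite inE /= => fg.
apply: ae_eq_fourier_coef; [exact: Lp_measurable (Lp_funP _)..|].
by move: fg; apply: filterS => t /[apply] /eqP; rewrite subr_eq0 => /eqP.
Qed.

End Lp_torus.

(* The subspace Y of X, with its own complete norm, is given as an abstract
   Banach space with an injective linear map iota into X, the inclusion. *)
Definition compactly_embedded (K : numFieldType) (Y : completeNormedModType K)
    (X : normedModType K) (iota : {linear Y -> X}) : Prop :=
  injective iota /\ compact (closure (iota @` [set y : Y | `|y| <= 1])).

(* Main.v *)
Require Import Defs.
From mathcomp Require Import all_boot all_order all_algebra.
From mathcomp Require Import all_classical all_reals all_analysis.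
From mathcomp Require Import measurable_realfun.
From mathcomp Require Import complex.
From mathcomp Require Import ring lra.
Import Order.TTheory GRing.Theory Num.Theory.
Import numFieldNormedType.Exports.
Import Normc.
Set Implicit Arguments.
Unset Strict Implicit.
Unset Printing Implicit Defensive.
Local Open Scope classical_set_scope.
Local Open Scope ring_scope.
Local Open Scope complex_scope.

(** The functionals c_n on L^p(T) are linear and uniformly Lipschitz
    ([Lp_torus_coef_le]), because the L^p norm dominates the L^1 norm on a set
    of finite measure, and they tend to 0 pointwise as |n| grows: this is the
    Riemann-Lebesgue lemma ([Lp_torus_coef_cvg0]).  A uniformly Lipschitz family
    that tends to 0 at every point tends to 0 uniformly on every compact set
    ([compact_unif_small]).  Applied to the closure of the image of the unit
    ball of Y, this shows that eps N, the supremum of |c_n y| over all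
    |n| >= N and all y in the unit ball, tends to 0; it is nonincreasing by
    construction, and homogeneity extends the bound from the unit ball to Y.

    The Riemann-Lebesgue lemma is obtained for every uniformly bounded orthogonal
    system on a set of finite measure ([orthogonal_coef_cvg0], due to Mercer).
    For a bounded function, the squares of the coefficients are summable by
    Bessel's inequality; an integrable function is an L^1 limit of simple ones,
    and the coefficients depend continuously on the function in L^1.  What
    remains is the orthogonality of the cosines and of the sines on one
    period. *)

(** * Coefficients along a bounded orthogonal system *)

Section orthogonal_system.
Import HBSimple.
Context d (T : measurableType d) (R : realType).
Variables (mu : {measure set T -> \bar R}) (D : set T).
Hypotheses (mD : measurable D) (muD : (mu D < +oo)%E).

(** Unlike integrability, this property is stable under products, so that every
    integral in the proof of Bessel's inequality exists. *)
Definition bounded_measurable (f : T -> R) : Prop :=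
  measurable_fun setT f /\ exists M : R, forall x, `|f x| <= M.

Lemma bounded_measurable_integrable f :
  bounded_measurable f -> mu.-integrable D (EFin \o f).
Proof.
move=> [mf [M fM]]; apply: measurable_bounded_integrable => //.
  exact: measurable_funTS.
by exists M; split; [exact: num_real|move=> N MN x _; exact/(le_trans (fM x))/ltW].
Qed.

Lemma bounded_measurableM f g : bounded_measurable f -> bounded_measurable g ->
  bounded_measurable (fun x => f x * g x).
Proof.
move=> [mf [M fM]] [mg [N gN]]; split; first exact: measurable_funM.
by exists (M * N) => x; rewrite normrM ler_pM.
Qed.

Lemma bounded_measurableZ a f : bounded_measurable f ->
  bounded_measurable (fun x => a * f x).
Proof.
move=> bf; apply: bounded_measurableM => //.
by split; [exact: measurable_cst|exists `|a|].
Qed.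

Lemma bounded_measurableB f g : bounded_measurable f -> bounded_measurable g ->
  bounded_measurable (fun x => f x - g x).
Proof.
move=> [mf [M fM]] [mg [N gN]]; split; first exact: measurable_funB.
by exists (M + N) => x; rewrite (le_trans (ler_normB _ _))// lerD.
Qed.

Lemma integrable_add f g :
  mu.-integrable D (EFin \o f) -> mu.-integrable D (EFin \o g) ->
  mu.-integrable D (EFin \o (fun x => f x + g x)).
Proof. by move=> fi gi; exact: (integrableD mD fi gi). Qed.

Lemma integrable_sub f g :
  mu.-integrable D (EFin \o f) -> mu.-integrable D (EFin \o g) ->
  mu.-integrable D (EFin \o (fun x => f x - g x)).
Proof. by move=> fi gi; exact: (integrableB mD fi gi). Qed.

Lemma integrable_scale a f : mu.-integrable D (EFin \o f) ->
  mu.-integrable D (EFin \o (fun x => a * f x)).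
Proof. by move=> fi; exact: (integrableZl mD a fi). Qed.

Lemma integrable_mul_bounded f g :
  mu.-integrable D (EFin \o f) -> bounded_measurable g ->
  mu.-integrable D (EFin \o (fun x => f x * g x)).
Proof.
move=> intf [mg [M gM]].
have -> : EFin \o (fun x => f x * g x) = ((EFin \o f) \* (EFin \o g))%E by [].
apply: integrableMl => //; first exact: measurable_funTS.
by exists M; split; [exact: num_real|move=> N MN x _; exact/(le_trans (gM x))/ltW].
Qed.

Variable e : nat -> T -> R.
Hypothesis me : forall k, measurable_fun setT (e k).
Hypothesis e1 : forall k x, `|e k x| <= 1.
Hypothesis orth : forall i j, i != j -> \int[mu]_(x in D) (e i x * e j x) = 0.

Let be k : bounded_measurable (e k).
Proof. by split => //; exists 1. Qed.

Definition coef (g : T -> R) k : R := \int[mu]_(x in D) (g x * e k x).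

Let bint := bounded_measurable_integrable.
Let bM := bounded_measurableM.
Let bZ := bounded_measurableZ.
Let bB := bounded_measurableB.

(** Bessel's inequality for an orthogonal system whose squared L^2 norms are
    at most c, hence the factors c: the residue r = c g - \sum_(k < N) a_k e_k,
    where a_k is the k-th coefficient of g, keeps the coefficients of c g beyond
    N, and subtracting a_N e_N lowers the integral of r^2 by at least c a_N^2. *)
Lemma bessel_residue (c : R) (g : T -> R) (N : nat) :
  fine (mu D) <= c -> bounded_measurable g ->
  exists r : T -> R, [/\ bounded_measurable r,
    forall k, (N <= k)%N -> coef r k = c * coef g k &
    \int[mu]_(x in D) (r x ^+ 2) + c * (\sum_(k < N) coef g k ^+ 2) <=
      c ^+ 2 * \int[mu]_(x in D) (g x ^+ 2)].
Proof.
move=> c0 bg; have bgg := bM bg bg.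
elim: N => [|N [r [br rk IH]]].
  exists (fun x => c * g x); split; first exact: bZ.
    move=> k _; rewrite /coef -RintegralZl//; last exact/bint/bM.
    by apply: eq_Rintegral => x _; rewrite mulrA.
  rewrite big_ord0 mulr0 addr0 -RintegralZl//; last exact: bint.
  by under eq_Rintegral do rewrite exprMn.
set a := coef g N in rk IH *.
exists (fun x => r x - a * e N x); split; first exact/bB/bZ.
  move=> k Nk; rewrite -rk; last exact: ltnW.
  rewrite /coef; under eq_Rintegral do rewrite mulrBl -mulrA.
  rewrite RintegralB//; [|exact/bint/bM|exact/bint/bZ/bM].
  rewrite RintegralZl//; last exact/bint/bM.
  by rewrite orth ?mulr0 ?subr0// ltn_eqF.
have -> : \int[mu]_(x in D) ((r x - a * e N x) ^+ 2) =
    \int[mu]_(x in D) (r x ^+ 2) - 2 * a * coef r N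
    + a ^+ 2 * \int[mu]_(x in D) (e N x * e N x).
  rewrite /coef -[X in _ - X]RintegralZl//; last exact/bint/bM.
  rewrite -[X in _ + X]RintegralZl//; last exact/bint/bM.
  rewrite -RintegralB//; [|exact/bint/(bM br br)|exact/bint/bZ/bM].
  rewrite -RintegralD//; [|exact/bint/(bB (bM br br))/bZ/bM|exact/bint/bZ/bM].
  by apply: eq_Rintegral => x _; ring.
have eN : \int[mu]_(x in D) (e N x * e N x) <= c.
  apply: le_trans c0; rewrite -[leRHS]mul1r -Rintegral_cst//.
  apply: le_Rintegral => //; [exact/bint/bM| |].
    by apply: bint; split; [exact: measurable_cst|exists 1 => x; rewrite normr1].
  by move=> x _; rewrite -expr2 -real_normK ?num_real// expr_le1.
rewrite big_ord_recr/= rk// -/a.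
have := ler_wpM2l (sqr_ge0 a) eN.
lra.
Qed.

(** The squared coefficients form a series with bounded partial sums. *)
Lemma bounded_coef_cvg0 (g : T -> R) : bounded_measurable g ->
  coef g @ \oo --> (0 : R).
Proof.
move=> bg.
(* the summand 1 only ensures that c is positive when D is negligible *)
pose c := fine (mu D) + 1.
have c0 : 0 < c by rewrite ltr_wpDl// fine_ge0.
have cv : cvgn (series (fun k => coef g k ^+ 2)).
  apply: nondecreasing_is_cvgn.
    by apply: nondecreasing_series => k _ _; exact: sqr_ge0.
  exists (c * \int[mu]_(x in D) (g x ^+ 2)) => _ [N _ <-].
  have [|r [_ _]] := @bessel_residue c g N _ bg; first by rewrite lerDl.
  (* dividing Bessel's inequality by c bounds the partial sums *)
  have := @Rintegral_ge0 _ _ _ mu D _ (fun x _ => sqr_ge0 (r x)).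
  move=> r0 h; rewrite seriesEord/= -(ler_pM2l c0) mulrA -expr2.
  by apply: le_trans h; rewrite lerDr.
have := cvg_series_cvg_0 cv.
move=> /cvgrPdist_lt h; apply/cvgrPdist_lt => eps e0.
have := h _ (exprn_gt0 2 e0); apply: filterS => k.
by rewrite !sub0r !normrN normrX ltr_pXn2r ?nnegrE// ltW.
Qed.

(** Replacing f by a simple function that is e/2-close in L^1 changes every
    coefficient by at most e/2, uniformly in k because |e_k| <= 1; simple
    functions are bounded, so [bounded_coef_cvg0] applies to them. *)
Lemma orthogonal_coef_cvg0 (f : T -> R) : mu.-integrable D (EFin \o f) ->
  coef f @ \oo --> (0 : R).
Proof.
move=> intf; apply/cvgrPdist_le => eps e0.
have [g_ [ig _ /fine_cvgP[fing]]] := approximation_sfun_integrable mD intf.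
move=> /cvgrPdist_lt /(_ (eps / 2)) /(_ (divr_gt0 e0 (ltr0n _ 2))) gf.
case: (filter_ex gf) => n gn.
pose g : T -> R := g_ n.
have bg : bounded_measurable g.
  split; first exact: measurable_funPT.
  have [M [_ fM]] := simple_bounded (g_ n).
  by exists (M + 1) => x; apply: fM => //; rewrite ltrDl.
have ifg : mu.-integrable D (EFin \o (fun x => f x - g x)).
  exact: (integrableB mD intf (bint bg)).
have fg : \int[mu]_(x in D) `|f x - g x| < eps / 2.
  by move: gn; rewrite sub0r normrN; apply: le_lt_trans; exact: ler_norm.
have /cvgrPdist_lt /(_ (eps / 2)) /(_ (divr_gt0 e0 (ltr0n _ 2))) 
  := bounded_coef_cvg0 bg.
apply: filterS => k; rewrite !sub0r !normrN => gk.
have -> : coef f k = \int[mu]_(x in D) ((f x - g x) * e k x) + coef g k.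
  rewrite -RintegralD//; [|exact: integrable_mul_bounded|exact/bint/bM].
  by apply: eq_Rintegral => x _; ring.
have ik := integrable_mul_bounded ifg (be k).
rewrite (splitr eps) (le_trans (ler_normD _ _))// lerD//; last exact: ltW.
apply: le_trans (ltW fg); apply: (le_trans (le_normr_Rintegral mD ik)).
apply: le_Rintegral => //; [exact: integrable_norm|exact: integrable_norm|].
by move=> x _; rewrite normrM ler_piMr.
Qed.

End orthogonal_system.

(** * Fourier coefficients of integrable functions *)

Section fourier_integrable.
Context {R : realType}.
Notation mu := (@lebesgue_measure R).

Lemma sin_natM2pi (n : nat) : sin (n%:R * (2 * pi)) = 0 :> R.
Proof.
rewrite mulr_natl [2 * pi]mulr_natl; elim: n => [|n IH].
  by rewrite mulr0n sin0.
by rewrite mulrSr sinD2pi.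
Qed.

(** Stated for a real frequency, so that it covers both i + j and i - j without
    ordering i and j. *)
Lemma Rintegral_cosM (a : R) : a != 0 -> sin (a * (2 * pi)) = 0 ->
  \int[mu]_(t in onecycle) cos (a * t) = 0.
Proof.
move=> a0 sa; have pi2 : 0 < 2 * pi :> R by rewrite mulr_gt0// pi_gt0.
pose F (t : R) := a^-1 * sin (a * t).
have dF (t : R) : is_derive t (1 : R) F (cos (a * t)).
  have h : is_derive t (1 : R) (fun x : R => a * x) a.
    by apply: is_derive_eq; rewrite /GRing.scale/= mulr1.
  have -> : cos (a * t) = a^-1 *: (cos (a * t) * a) :> R.
    by rewrite /GRing.scale/= mulrCA mulVf ?mulr1.
  exact: is_deriveZ.
have cF : continuous F.
  by move=> t; apply/differentiable_continuous/derivable1_diffP; case: (dF t).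
rewrite /Rintegral (@continuous_FTC2 _ _ F)//.
- by rewrite /F sa mulr0 mulr0 sin0 mulr0 subee.
- apply/continuous_subspaceT => t; apply: continuous_comp.
    exact: mulrl_continuous.
  exact: continuous_cos.
- split.
  + by move=> t _; case: (dF t).
  + by apply: cvg_at_right_filter; exact: cF.
  + by apply: cvg_at_left_filter; exact: cF.
- by move=> t _; rewrite derive1E; case: (dF t).
Qed.

Lemma measurable_cosM (a : R) : measurable_fun setT (fun t => cos (a * t)).
Proof.
apply: (measurableT_comp (f := @cos R)); last exact: measurable_funM.
by apply: continuous_measurable_fun; exact: continuous_cos.
Qed.

Lemma measurable_sinM (a : R) : measurable_fun setT (fun t => sin (a * t)).
Proof.
apply: (measurableT_comp (f := @sin R)); last exact: measurable_funM.
by apply: continuous_measurable_fun; exact: continuous_sin.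
Qed.

Lemma onecycle_measure : mu onecycle = (2 * pi)%:E.
Proof.
by rewrite /onecycle lebesgue_measure_itv/= lte_fin mulr_gt0 ?pi_gt0// sube0.
Qed.

Lemma onecycle_finite : (mu onecycle < +oo)%E.
Proof. by rewrite onecycle_measure ltry. Qed.

Let cos_bm (a : R) : bounded_measurable (fun t : R => cos (a * t)).
Proof. by split; [exact: measurable_cosM|exists 1 => t; exact: cos_max]. Qed.

Let sin_bm (a : R) : bounded_measurable (fun t : R => sin (a * t)).
Proof. by split; [exact: measurable_sinM|exists 1 => t; exact: sin_max]. Qed.

Lemma cos_sin_orthogonal (i j : nat) : i != j ->
  \int[mu]_(t in onecycle) (cos (i%:R * t) * cos (j%:R * t)) = 0 /\
  \int[mu]_(t in onecycle) (sin (i%:R * t) * sin (j%:R * t)) = 0.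
Proof.
move=> ij; have mD := @measurable_onecycle R.
have int a : mu.-integrable onecycle (EFin \o (fun t : R => cos (a * t))).
  by apply: bounded_measurable_integrable ; [|exact: onecycle_finite|exact: cos_bm].
have Im : \int[mu]_(t in onecycle) cos ((i%:R - j%:R) * t) = 0.
  apply: Rintegral_cosM; first by rewrite subr_eq0 eqr_nat.
  by rewrite mulrBl sinB !sin_natM2pi mul0r mulr0 subr0.
have Ip : \int[mu]_(t in onecycle) cos ((i%:R + j%:R) * t) = 0.
  apply: Rintegral_cosM; last by rewrite -natrD sin_natM2pi.
  by rewrite -natrD pnatr_eq0 addn_eq0; apply: contra ij => /andP[/eqP-> /eqP->].
split.
  rewrite (@eq_Rintegral _ _ R mu onecycle
    (fun t : R => 2^-1 * (cos ((i%:R - j%:R) * t) + cos ((i%:R + j%:R) * t)))).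
    rewrite RintegralZl// ?RintegralD// ?Im ?Ip ?addr0 ?mulr0//.
    by apply: integrable_add.
  by move=> t _; rewrite mulrBl mulrDl cosB cosD; field.
rewrite (@eq_Rintegral _ _ R mu onecycle
  (fun t : R => 2^-1 * (cos ((i%:R - j%:R) * t) - cos ((i%:R + j%:R) * t)))).
  rewrite RintegralZl// ?RintegralB// ?Im ?Ip ?subr0 ?mulr0//.
  by apply: integrable_sub.
by move=> t _; rewrite mulrBl mulrDl cosB cosD; field.
Qed.

Definition cos_coef (g : R -> R) (k : nat) : R :=
  \int[mu]_(t in onecycle) (g t * cos (k%:R * t)).
Definition sin_coef (g : R -> R) (k : nat) : R :=
  \int[mu]_(t in onecycle) (g t * sin (k%:R * t)).

Lemma trig_coef_cvg0 (g : R -> R) : mu.-integrable onecycle (EFin \o g) ->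
  cos_coef g @ \oo --> (0 : R) /\ sin_coef g @ \oo --> (0 : R).
Proof.
move=> ig; have mD := @measurable_onecycle R; split.
  apply: (orthogonal_coef_cvg0 (mu := mu) mD onecycle_finite
    (e := fun k t => cos (k%:R * t))) ig.
  - by move=> k; exact: measurable_cosM.
  - by move=> k t; exact: cos_max.
  - by move=> i j /cos_sin_orthogonal[].
apply: (orthogonal_coef_cvg0 (mu := mu) mD onecycle_finite
    (e := fun k t => sin (k%:R * t))) ig.
- by move=> k; exact: measurable_sinM.
- by move=> k t; exact: sin_max.
- by move=> i j /cos_sin_orthogonal[].
Qed.

Lemma trig_coef_le (g h : R -> R) (k : nat) :
  mu.-integrable onecycle (EFin \o g) -> mu.-integrable onecycle (EFin \o h) ->
  (forall t, `|g t| <= h t) ->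
  `|cos_coef g k| <= \int[mu]_(t in onecycle) h t /\
  `|sin_coef g k| <= \int[mu]_(t in onecycle) h t.
Proof.
move=> ig ih gh; have mD := @measurable_onecycle R.
have H e : bounded_measurable e -> (forall t, `|e t| <= 1) ->
    `|\int[mu]_(t in onecycle) (g t * e t)| <= \int[mu]_(t in onecycle) h t.
  move=> be e1; have ige :
      mu.-integrable onecycle (EFin \o (fun t => g t * e t)).
    by apply: integrable_mul_bounded.
  apply: le_trans; first by apply: le_normr_Rintegral.
  apply: le_Rintegral => //; first by apply: integrable_norm.
  by move=> t _; rewrite normrM (le_trans _ (gh t))// ler_piMr.
split; apply: H; [exact: cos_bm|by move=> t; exact: cos_max|exact: sin_bm|].
by move=> t; exact: sin_max.
Qed.

Definition cintegrable (f : R -> R[i]) : Prop :=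
  mu.-integrable onecycle (EFin \o (fun t => complex.Re (f t))) /\
  mu.-integrable onecycle (EFin \o (fun t => complex.Im (f t))).

Lemma cintegral_linear (a : R[i]) f g : cintegrable f -> cintegrable g ->
  cintegral (fun t => a * f t + g t) = a * cintegral f + cintegral g.
Proof.
move=> [fr fi] [gr gi]; have mD := @measurable_onecycle R.
case: a => a b.
have Z c (h : R -> R) : mu.-integrable onecycle (EFin \o h) ->
    mu.-integrable onecycle (EFin \o (fun t => c * h t)).
  by apply: integrable_scale.
rewrite /cintegral.
have -> : \int[mu]_(t in onecycle) complex.Re ((a +i* b) * f t + g t) =
    (a * \int[mu]_(t in onecycle) complex.Re (f t)
     - b * \int[mu]_(t in onecycle) complex.Im (f t))
    + \int[mu]_(t in onecycle) complex.Re (g t).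
  rewrite -!RintegralZl// -RintegralB//; [|exact: Z|exact: Z].
  rewrite -RintegralD//; last by apply: integrable_sub => //; exact: Z.
  by apply: eq_Rintegral => t _; case: (f t) (g t) => [? ?] [? ?].
have -> : \int[mu]_(t in onecycle) complex.Im ((a +i* b) * f t + g t) =
    (a * \int[mu]_(t in onecycle) complex.Im (f t)
     + b * \int[mu]_(t in onecycle) complex.Re (f t))
    + \int[mu]_(t in onecycle) complex.Im (g t).
  rewrite -!RintegralZl// -RintegralD//; [|exact: Z|exact: Z].
  rewrite -RintegralD//; last by apply: integrable_add => //; exact: Z.
  by apply: eq_Rintegral => t _; case: (f t) (g t) => [? ?] [? ?].
by [].
Qed.

Let expi_bm (n : int) :
  bounded_measurable (fun t : R => complex.Re (expi (- (n%:~R * t)))) /\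
  bounded_measurable (fun t : R => complex.Im (expi (- (n%:~R * t)))).
Proof.
have [mr mi] := cmeasurable_expi R n.
split; split => //; exists 1 => t; [exact: cos_max|exact: sin_max].
Qed.

Lemma cintegrable_expi f (n : int) : cintegrable f ->
  cintegrable (fun t => f t * expi (- (n%:~R * t))).
Proof.
move=> [fr fi]; have mD := @measurable_onecycle R.
have [er ei] := expi_bm n; pose E (t : R) := expi (- (n%:~R * t)).
have M g e : mu.-integrable onecycle (EFin \o g) -> bounded_measurable e ->
    mu.-integrable onecycle (EFin \o (fun t => g t * e t)).
  by apply: integrable_mul_bounded.
split.
  rewrite [X in EFin \o X](_ : _ = fun t => complex.Re (f t) * complex.Re (E t) -
      complex.Im (f t) * complex.Im (E t)).
    by apply: integrable_sub => //; exact: M.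
  by apply/funext => t; rewrite /E; case: (f t).
rewrite [X in EFin \o X](_ : _ = fun t => complex.Re (f t) * complex.Im (E t) +
    complex.Im (f t) * complex.Re (E t)).
  by apply: integrable_add => //; exact: M.
by apply/funext => t; rewrite /E; case: (f t).
Qed.

Lemma fourier_coef_linear (a : R[i]) f g n : cintegrable f -> cintegrable g ->
  fourier_coef (fun t => a * f t + g t) n =
  a * fourier_coef f n + fourier_coef g n.
Proof.
move=> cf cg; rewrite /fourier_coef.
under [X in cintegral X]eq_fun do rewrite mulrDl -mulrA.
rewrite cintegral_linear; [|exact: cintegrable_expi..].
by rewrite mulrDr mulrCA.
Qed.

Lemma normc_le (x y : R) : normc (x +i* y) <= `|x| + `|y|.
Proof.
rewrite /= -[leRHS]ger0_norm ?addr_ge0// -sqrtr_sqr ler_wsqrtr//.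
rewrite sqrrD !real_normK ?num_real// lerD2r lerDl.
by rewrite mulrn_wge0// mulr_ge0.
Qed.

(** The frequency n enters through |n| only: its sign changes the sign of the
    sine terms, which the triangle inequality absorbs.  Both the Lipschitz bound
    and the Riemann-Lebesgue lemma follow from this estimate. *)
Lemma fourier_coef_le f (n : int) : cintegrable f ->
  normc (fourier_coef f n) <= (2 * pi)^-1 *
    (`|cos_coef (fun t => complex.Re (f t)) `|n|%N| +
     `|sin_coef (fun t => complex.Im (f t)) `|n|%N| +
    (`|cos_coef (fun t => complex.Im (f t)) `|n|%N| +
     `|sin_coef (fun t => complex.Re (f t)) `|n|%N|)).
Proof.
move=> [fr fi]; have mD := @measurable_onecycle R.
have nn t : n%:~R * t = (-1) ^+ (n < 0)%R * ((`|n|%N)%:R * t) :> R.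
  by rewrite {1}[n]intEsign rmorphM rmorph_sign mulrA.
pose s : R := (-1) ^+ (n < 0)%R.
have cE t : cos (- (n%:~R * t)) = cos ((`|n|%N)%:R * t) :> R.
  by rewrite cosN nn; case: (n < 0)%R; rewrite ?mulN1r ?mul1r ?cosN.
have sE t : sin (- (n%:~R * t)) = - s * sin ((`|n|%N)%:R * t) :> R.
  rewrite sinN nn /s; case: (n < 0)%R;
    by rewrite ?expr1 ?expr0 ?mulN1r ?mul1r ?sinN ?mulNr ?mul1r.
have s1 : `|s| = 1 by rewrite normr_sign.
have M g e : mu.-integrable onecycle (EFin \o g) -> bounded_measurable e ->
    mu.-integrable onecycle (EFin \o (fun t => g t * e t)).
  by apply: integrable_mul_bounded.
have MZ c g e : mu.-integrable onecycle (EFin \o g) -> bounded_measurable e ->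
    mu.-integrable onecycle (EFin \o (fun t => c * (g t * e t))).
  by move=> ig be; apply: integrable_scale => //; exact: M.
rewrite /fourier_coef normcM.
have -> : normc ((2 * pi)^-1%:C) = (2 * pi)^-1 :> R.
  by rewrite /= expr0n/= addr0 sqrtr_sqr ger0_norm// invr_ge0 mulr_ge0// pi_ge0.
rewrite ler_wpM2l ?invr_ge0 ?mulr_ge0 ?pi_ge0//.
rewrite /cintegral.
have -> : \int[mu]_(t in onecycle) complex.Re (f t * expi (- (n%:~R * t))) =
   cos_coef (fun t => complex.Re (f t)) `|n|%N +
   s * sin_coef (fun t => complex.Im (f t)) `|n|%N.
  rewrite -RintegralZl//; last exact: M _ _ fi (sin_bm _).
  rewrite -RintegralD//;
    [|exact: M _ _ fr (cos_bm _)|exact: MZ _ _ _ fi (sin_bm _)].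
  by apply: eq_Rintegral => t _; rewrite /expi cE sE; case: (f t) => u v /=; ring.
have -> : \int[mu]_(t in onecycle) complex.Im (f t * expi (- (n%:~R * t))) =
   cos_coef (fun t => complex.Im (f t)) `|n|%N -
   s * sin_coef (fun t => complex.Re (f t)) `|n|%N.
  rewrite -RintegralZl//; last exact: M _ _ fr (sin_bm _).
  rewrite -RintegralB//;
    [|exact: M _ _ fi (cos_bm _)|exact: MZ _ _ _ fr (sin_bm _)].
  by apply: eq_Rintegral => t _; rewrite /expi cE sE; case: (f t) => u v /=; ring.
apply: (le_trans (normc_le _ _)); apply: lerD.
  by rewrite (le_trans (ler_normD _ _))// normrM s1 mul1r.
by rewrite (le_trans (ler_normB _ _))// normrM s1 mul1r.
Qed.

End fourier_integrable.

(** * Fourier coefficients on L^p *)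

(** A bound for the norms of the functionals c_n on L^p that does not depend on
    n: for f of norm 1, each of the four integrals in [fourier_coef_le] is at
    most the L^1 norm of f, hence at most 2 pi + 1 by [Lp_int_normc_le]. *)
Definition fourier_const (R : realType) : R :=
  (2 * pi)^-1 * (4 * (2 * pi + 1)).

Section Lp_fourier.
Context {R : realType}.
Notation mu := (@lebesgue_measure R).
Variables (p : R) (p1 : 1 <= p).

(** Integrated over one period, this pointwise bound yields the inclusion of L^p
    into L^1 for all exponents p >= 1 at once. *)
Lemma le1DpowR (s : R) : 0 <= s -> s <= 1 + s `^ p.
Proof.
move=> s0; have [s1|/ltW s1] := leP s 1.
  by rewrite (le_trans s1)// lerDl powR_ge0.
rewrite -[leLHS]add0r lerD// -[leLHS]powRr1//.
exact: ler_powR.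
Qed.

Lemma Lp_int_powR (f : R -> R[i]) : is_Lp_periodic p f ->
  mu.-integrable onecycle (EFin \o (fun t => normc (f t) `^ p)).
Proof.
move=> Lf; apply/integrableP; split.
  apply/measurable_EFinP; apply: measurable_funTS.
  exact: cmeasurable_normcX (Lp_measurable Lf).
apply: le_lt_trans (Lp_finite Lf); rewrite le_eqVlt; apply/orP; left; apply/eqP.
by apply: eq_integral => t _ /=; rewrite ger0_norm// powR_ge0.
Qed.

Lemma onecycle_int_cst (c : R) : mu.-integrable onecycle (EFin \o cst c).
Proof.
apply: measurable_bounded_integrable => //.
- exact: measurable_onecycle.
- exact: onecycle_finite.
- exact: bounded_cst.
Qed.

Lemma Lp_integrable_normc (f : R -> R[i]) : is_Lp_periodic p f ->
  mu.-integrable onecycle (EFin \o (fun t => normc (f t))).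
Proof.
move=> Lf; have mD := @measurable_onecycle R.
have : mu.-integrable onecycle (EFin \o (fun t => 1 + normc (f t) `^ p)).
  apply: integrable_add => //; first exact: (onecycle_int_cst 1).
  exact: Lp_int_powR.
apply: le_integrable => //.
  apply/measurable_EFinP; apply: measurable_funTS.
  exact: cmeasurable_normc (Lp_measurable Lf).
move=> t _ /=; rewrite lee_fin ger0_norm ?normc_ge0// ger0_norm.
  by rewrite le1DpowR// normc_ge0.
by rewrite addr_ge0// powR_ge0.
Qed.

Lemma normr_Re_le (z : R[i]) : `|complex.Re z| <= normc z.
Proof. by case: z => a b /=; rewrite -sqrtr_sqr ler_wsqrtr// lerDl sqr_ge0. Qed.

Lemma normr_Im_le (z : R[i]) : `|complex.Im z| <= normc z.
Proof. by case: z => a b /=; rewrite -sqrtr_sqr ler_wsqrtr// lerDr sqr_ge0. Qed.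

Lemma Lp_cintegrable (f : R -> R[i]) : is_Lp_periodic p f -> cintegrable f.
Proof.
move=> Lf; have mD := @measurable_onecycle R.
have [mr mi] := Lp_measurable Lf.
split; apply: le_integrable (Lp_integrable_normc Lf) => //.
- by apply/measurable_EFinP; exact: measurable_funTS.
- move=> t _ /=; rewrite lee_fin [leRHS]ger0_norm ?normc_ge0//.
  exact: normr_Re_le.
- by apply/measurable_EFinP; exact: measurable_funTS.
- move=> t _ /=; rewrite lee_fin [leRHS]ger0_norm ?normc_ge0//.
  exact: normr_Im_le.
Qed.

Lemma Lp_int_normc_le1 (f : R -> R[i]) : is_Lp_periodic p f ->
  Lp_norm p f <= 1 -> \int[mu]_(t in onecycle) normc (f t) <= 2 * pi + 1.
Proof.
move=> Lf f1; have mD := @measurable_onecycle R.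
have p0 : 0 < p by rewrite (lt_le_trans ltr01).
have I1 : \int[mu]_(t in onecycle) (normc (f t) `^ p) <= 1.
  rewrite leNgt; apply/negP => I1; move: f1; rewrite leNgt => /negP; apply.
  rewrite unlock [ltLHS](_ : 1 = 1 `^ p^-1); last by rewrite powR1.
  by rewrite gt0_ltr_powR ?invr_gt0 ?nnegrE ?(ltW I1)// ltW// (lt_trans ltr01).
apply: (@le_trans _ _ (\int[mu]_(t in onecycle) (1 + normc (f t) `^ p))).
  apply: le_Rintegral => //; first exact: Lp_integrable_normc.
    apply: integrable_add => //; first exact: (onecycle_int_cst 1).
    exact: Lp_int_powR.
  by move=> t _; rewrite le1DpowR// normc_ge0.
rewrite RintegralD//; [|exact: (onecycle_int_cst 1)|exact: Lp_int_powR].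
rewrite Rintegral_cst// mul1r [X in fine X + _](_ : _ = (2 * pi)%:E).
  by rewrite lerD2l.
exact: onecycle_measure.
Qed.

(** By homogeneity from the unit ball; dividing by ||f|| + e instead of ||f||
    covers the functions of norm 0. *)
Lemma Lp_int_normc_le (f : R -> R[i]) : is_Lp_periodic p f ->
  \int[mu]_(t in onecycle) normc (f t) <= (2 * pi + 1) * Lp_norm p f.
Proof.
move=> Lf; have mD := @measurable_onecycle R.
have c0 : 0 < 2 * pi + 1 :> R by rewrite ltr_wpDl// mulr_ge0// pi_ge0.
have N0 : 0 <= Lp_norm p f by exact: Lp_norm_ge0.
rewrite -ler_pdivrMl//; apply/ler_addgt0Pr => e e0.
set s := Lp_norm p f + e; have s0 : 0 < s by rewrite ltr_wpDl.
have ns : normc ((s^-1)%:C) = s^-1 :> R.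
  by rewrite /= expr0n/= addr0 sqrtr_sqr ger0_norm// invr_ge0 ltW.
have sf1 : Lp_norm p (fun t => (s^-1)%:C * f t) <= 1.
  by rewrite Lp_normZ// ns ler_pdivrMl// mulr1 lerDl ltW.
have := Lp_int_normc_le1 (Lp_periodicZ (s^-1)%:C p1 Lf) sf1.
under eq_Rintegral do rewrite normcM ns.
rewrite RintegralZl//; last exact: Lp_integrable_normc.
by rewrite !ler_pdivrMl// [s * _]mulrC.
Qed.

Lemma Lp_fourier_coef_le_norm (f : R -> R[i]) n : is_Lp_periodic p f ->
  normc (fourier_coef f n) <= fourier_const R * Lp_norm p f.
Proof.
move=> Lf; have [fr fi] := Lp_cintegrable Lf.
apply: (le_trans (fourier_coef_le n (Lp_cintegrable Lf))).
rewrite -mulrA ler_wpM2l ?invr_ge0 ?mulr_ge0 ?pi_ge0// -mulrA.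
have [c1 s1] := trig_coef_le `|n|%N fr (Lp_integrable_normc Lf)
  (fun t => normr_Re_le (f t)).
have [c2 s2] := trig_coef_le `|n|%N fi (Lp_integrable_normc Lf)
  (fun t => normr_Im_le (f t)).
have := Lp_int_normc_le Lf; lra.
Qed.

Lemma Lp_fourier_coef_cvg0 (f : R -> R[i]) (e : R) : is_Lp_periodic p f ->
  0 < e -> \forall N \near \oo,
    forall n : int, (N <= `|n|)%N -> normc (fourier_coef f n) <= e.
Proof.
move=> Lf e0; have cf := Lp_cintegrable Lf.
have pi0 : 0 < pi :> R := pi_gt0 R.
pose d := (2 * pi) * (e / 4).
have d0 : 0 < d by rewrite !mulr_gt0.
have [/cvgrPdist_le /(_ _ d0) [N1 _ c1] /cvgrPdist_le /(_ _ d0) [N2 _ s1]] :=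
  trig_coef_cvg0 cf.1.
have [/cvgrPdist_le /(_ _ d0) [N3 _ c2] /cvgrPdist_le /(_ _ d0) [N4 _ s2]] :=
  trig_coef_cvg0 cf.2.
exists (N1 + N2 + (N3 + N4))%N => // N /= leN n nN.
have {}leN := leq_trans leN nN.
apply: (le_trans (fourier_coef_le n cf)).
have {}c1 := c1 `|n|%N (leq_trans (leq_trans (leq_addr _ _) (leq_addr _ _)) leN).
have {}s1 := s1 `|n|%N (leq_trans (leq_trans (leq_addl _ _) (leq_addr _ _)) leN).
have {}c2 := c2 `|n|%N (leq_trans (leq_trans (leq_addr _ _) (leq_addl _ _)) leN).
have {}s2 := s2 `|n|%N (leq_trans (leq_trans (leq_addl _ _) (leq_addl _ _)) leN).
move: c1 s1 c2 s2; rewrite /= !sub0r !normrN => c1 s1 c2 s2.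
rewrite ler_pdivrMl ?mulr_gt0// -[X in _ <= _ * X](_ : e / 4 * 4 = e); last by field.
rewrite mulrA -/d; lra.
Qed.

Lemma Lp_torus_coef_linear (a : R[i]) (x y : Lp_torus p1) n :
  Lp_fourier_coef (a *: x + y) n =
  a * Lp_fourier_coef x n + Lp_fourier_coef y n.
Proof.
rewrite -(pi_Lp_repr x) -(pi_Lp_repr y).
rewrite -[a *: _]pi_LpZ -pi_LpD !Lp_fourier_coef_pi.
by apply: fourier_coef_linear; apply: Lp_cintegrable; exact: Lp_funP.
Qed.

Lemma Lp_torus_coef_le (x : Lp_torus p1) n :
  `|Lp_fourier_coef x n| <= (fourier_const R)%:C * `|x|.
Proof.
rewrite -[in leRHS](pi_Lp_repr x) [`|pi_Lp _|]Lp_torus_norm_pi -rmorphM.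
rewrite -[leLHS]/((normc _)%:C) lecR.
by apply: Lp_fourier_coef_le_norm; exact: Lp_funP.
Qed.

Lemma Lp_torus_coef_cvg0 (x : Lp_torus p1) (e : R) : 0 < e ->
  \forall N \near \oo, forall n : int, (N <= `|n|)%N ->
    `|Lp_fourier_coef x n| <= e%:C.
Proof.
move=> e0; apply: filterS (Lp_fourier_coef_cvg0 (Lp_funP (repr x)) e0) => N h n nN.
by rewrite -[leLHS]/((normc _)%:C) lecR; exact: h.
Qed.

End Lp_fourier.

(** * Uniform convergence on compact sets *)

(** Each point x has a ball on which |c_i| <= e as soon as h i is large, since
    |c_i x| <= e/2 for such i and the Lipschitz bound controls the oscillation
    on a ball of radius e/(2C); finitely many of these balls cover A.  The
    function h replaces a filter on I: with I = int and h the absolute value, it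
    expresses that |n| tends to infinity. *)
Lemma compact_unif_small (K : numFieldType) (X V : normedModType K)
    (I : Type) (h : I -> nat) (c : I -> X -> V) (C : K) (A : set X) :
  0 < C -> (forall i x y, `|c i x - c i y| <= C * `|x - y|) ->
  (forall x e, 0 < e ->
    \forall N \near \oo, forall i, (N <= h i)%N -> `|c i x| <= e) ->
  compact A -> forall e, 0 < e ->
  \forall N \near \oo, forall x, A x -> forall i, (N <= h i)%N -> `|c i x| <= e.
Proof.
move=> C0 lipc ptc /compact_near_coveringP cA e e0.
apply: (cA nat \oo (fun N x => forall i, (N <= h i)%N -> `|c i x| <= e)) => x Ax.
have e20 : 0 < e / 2 by rewrite divr_gt0.
exists (ball x (e / 2 / C), [set N | forall i, (N <= h i)%N -> `|c i x| <= e / 2]).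
  split; last exact: ptc.
  by apply: nbhsx_ballx; rewrite divr_gt0.
move=> [x' N] /= [xx' hN] i Ni.
rewrite -(subrK (c i x) (c i x')) (splitr e) (le_trans (ler_normD _ _))//.
rewrite lerD ?hN// (le_trans (lipc i x' x))// distrC mulrC -ler_pdivlMr//.
by move: xx'; rewrite -ball_normE => /ltW.
Qed.

(** Over R[i] the norm has complex values, while the suprema below are taken in
    R; hence a bound of the form M%:C with M real. *)
Lemma compact_norm_le (R : realType) (X : normedModType R[i]) (A : set X) :
  compact A -> exists M : R, forall x, A x -> `|x| <= M%:C.
Proof.
move=> /compact_near_coveringP cA.
suff : \forall N \near \oo, A `<=` [set x : X | `|x| <= (N%:R : R)%:C].
  by case/filter_ex => N AN; exists N%:R.
apply: (cA nat \oo (fun (N : nat) (x : X) => `|x| <= (N%:R : R)%:C)) => x Ax.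
pose r := complex.Re `|x|.
have rx : `|x| = r%:C by rewrite RRe_real// normr_real.
have r0 : 0 <= r by rewrite -ler0c -rx.
exists (ball x 1, [set N | (Num.truncn r).+2 <= N]%N).
  by split; [exact: nbhsx_ballx|exists (Num.truncn r).+2].
move=> [x' N] /= [xx' hN].
have : `|x'| <= `|x| + 1.
  rewrite -lerBlDl (le_trans (lerB_dist _ _))// distrC.
  by move: xx'; rewrite -ball_normE => /ltW.
move=> /le_trans; apply; rewrite rx -(rmorph1 (real_complex R)) -rmorphD lecR.
have : ((Num.truncn r).+2%:R : R) <= N%:R by rewrite ler_nat.
apply: le_trans; rewrite -[X in _ <= X]natr1 lerD2r ltW//.
by rewrite truncnS_gt.
Qed.

(** * The decay rate on the unit ball of Y *)

Theorem corollary2p3 (R : realType) (p : R) (p1 : 1 <= p)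
    (Y : completeNormedModType R[i]) (iota : {linear Y -> Lp_torus p1}) :
  compactly_embedded iota ->
  exists eps : nat -> R,
    [/\ forall n : nat, 0 <= eps n,
        nonincreasing_seq eps,
        eps @ \oo --> (0 : R) &
        forall (n : int) (y : Y),
          `|Lp_fourier_coef (iota y) n| <= (eps `|n|%N)%:C * `|y|].
Proof.
move=> [_ cpt].
have C0 : 0 < fourier_const R.
  have pi0 := pi_gt0 R.
  by rewrite /fourier_const mulr_gt0 ?invr_gt0 ?mulr_gt0// addr_gt0 ?mulr_gt0.
have lip n (x y : Lp_torus p1) : `|Lp_fourier_coef x n - Lp_fourier_coef y n| <=
    (fourier_const R)%:C * `|x - y|.
  suff -> : Lp_fourier_coef x n - Lp_fourier_coef y n =
            Lp_fourier_coef (x - y) n by exact: Lp_torus_coef_le.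
  have -> : x - y = -1 *: y + x by rewrite scaleN1r addrC.
  by rewrite Lp_torus_coef_linear mulN1r addrC.
have inA y : `|y| <= 1 ->
    closure (iota @` [set y : Y | `|y| <= 1]) (iota y).
  by move=> y1; apply: subset_closure; exists y.
have coef0 n : Lp_fourier_coef (0 : Lp_torus p1) n = 0.
  apply/eqP; rewrite -normr_le0; apply: le_trans (Lp_torus_coef_le 0 n) _.
  by rewrite normr0 mulr0.
have [M AM] := compact_norm_le cpt.
have unif (e : R) : 0 < e -> \forall N \near \oo, forall y : Y, `|y| <= 1 ->
    forall n : int, (N <= `|n|)%N -> `|Lp_fourier_coef (iota y) n| <= e%:C.
  move=> e0.
  have pt (x : Lp_torus p1) (e' : R[i]) : 0 < e' -> \forall N \near \oo,
      forall n : int, (N <= `|n|)%N -> `|Lp_fourier_coef x n| <= e'.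
    move=> e'0; have -> : e' = (complex.Re e')%:C by rewrite RRe_real// gtr0_real.
    apply: Lp_torus_coef_cvg0.
    by move: e'0; rewrite ltcE => /andP[].
  have eC : 0 < e%:C by rewrite ltcR.
  have CC : 0 < (fourier_const R)%:C by rewrite ltcR.
  have := @compact_unif_small R[i] (Lp_torus p1) R[i]^o int absz
    (fun n x => Lp_fourier_coef x n) _ _ CC lip pt cpt _ eC.
  by apply: filterS => N h y y1 n Nn; apply: h => //; exact: inA.
pose S (N : nat) := [set r : R | exists n : int, exists y : Y,
  [/\ (N <= `|n|)%N, `|y| <= 1 & r = normc (Lp_fourier_coef (iota y) n)]].
have S0 N : S N 0.
  exists N%:Z, 0; split => //; first by rewrite normr0.
  by rewrite linear0 coef0 normc0.
have ubS N : has_ubound (S N).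
  exists (fourier_const R * M) => _ [n [y [_ y1 ->]]].
  rewrite -lecR rmorphM; apply: (le_trans (Lp_torus_coef_le (iota y) n)).
  apply: ler_wpM2l; first by rewrite ler0c ltW.
  by apply: AM; exact: inA.
have S_le N (e : R) : (forall r, S N r -> r <= e) -> sup (S N) <= e.
  by move=> h; apply: ge_sup => //; exists 0; exact: S0.
exists (fun N => sup (S N)); split.
- by move=> N; apply: ub_le_sup.
- move=> N N' NN'; apply: S_le => _ [n [y [nN y1 ->]]].
  by apply: ub_le_sup => //; exists n, y; split => //; exact: leq_trans nN.
- apply/cvgrPdist_le => e e0; have := unif _ e0; apply: filterS => N h.
  rewrite sub0r normrN ger0_norm; last by apply: ub_le_sup.
  by apply: S_le => _ [n [y [nN y1 ->]]]; rewrite -lecR; exact: h.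
- move=> n y; have [->|y0] := eqVneq y 0.
    by rewrite linear0 coef0 !normr0 mulr0.
  have ny : 0 < `|y| by rewrite normr_gt0.
  have -> : y = `|y| *: (`|y|^-1 *: y) by rewrite scalerA divff ?scale1r// gt_eqF.
  set z := `|y|^-1 *: y.
  have z1 : `|z| = 1 by rewrite normrZ normfV normr_id mulVf// gt_eqF.
  rewrite linearZ/= -[_ *: iota z]addr0 Lp_torus_coef_linear coef0 addr0.
  rewrite normrM normrZ z1 mulr1 normr_id mulrC ler_wpM2r//.
  rewrite -[leLHS]/((normc _)%:C) lecR; apply: ub_le_sup => //.
  by exists n, z; rewrite z1.
Qed.
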